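(* Let $\Omega\subset\mathbb{R}^n$ be open. Let $\varphi\in\Phi_{\mathrm w}(\Omega)$ satisfy (A0), (A1) and (A2), and suppose that the maximal operator $M$ is bounded from $L^\varphi(\Omega)$ to $L^\varphi(\Omega)$. Then for every $\varepsilon>0$ the restriction $\varphi|_{\Omega_\varepsilon}$ satisfies (aInc)$^\infty$, i.e. there exist $p>1$ and $t_0>0$ such that $\varphi$ satisfies (aInc)$_p$ on $\Omega_\varepsilon\times[t_0,\infty)$.
   Context: $|A|$ denotes Lebesgue measure. A function $f$ is $L$-almost increasing ($L\ge1$) if $f(s)\le L f(t)$ for all $s<t$. $\Omega_\varepsilon:=\{x\in\Omega:\operatorname{dist}(x,\mathbb{R}^n\setminus\Omega)>\varepsilon\}$; in particular $\Omega_\varepsilon=\mathbb{R}^n$ if $\Omega=\mathbb{R}^n$. Weak $\Phi$-functions: $\varphi:\Omega\times[0,\infty)\to[0,\infty]$ belongs to $\Phi_{\mathrm w}(\Omega)$ if: (i) for every measurable $f:\Omega\to\mathbb{R}$ the function $x\mapsto\varphi(x,|f(x)|)$ is measurable, and for every $x\in\Omega$ the function $t\mapsto\varphi(x,t)$ is non-decreasing; (ii) $\varphi(x,0)=\lim_{t\to0^+}\varphi(x,t)=0$ and $\lim_{t\to\infty}\varphi(x,t)=\infty$ for every $x\in\Omega$; (iii) $t\mapsto\varphi(x,t)/t$ is $L$-almost increasing on $(0,\infty)$ with $L$ independent of $x$. If $\varphi$ does not depend on $x$ we write $\varphi\in\Phi_{\mathrm w}$. Generalized inverse: $\varphi^{-1}(x,t):=\inf\{\tau\ge0:\varphi(x,\tau)\ge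 t\}$. (aInc)$_p$ on $A\times T$ ($A\subset\Omega$, $T\subset[0,\infty)$): there is $a\ge1$ with $\frac{\varphi(x,t)}{t^p}\le a\frac{\varphi(x,s)}{s^p}$ for all $t,s\in T$ with $0<t<s$ and almost all $x\in A$. (A0): there exists $\beta\in(0,1]$ such that $\beta\le\varphi^{-1}(x,1)\le\frac1\beta$ for almost every $x\in\Omega$. (A1): there exists $\beta\in(0,1)$ such that $\beta\varphi^{-1}(x,t)\le\varphi^{-1}(y,t)$ for every $t\in[1,\frac1{|B|}]$, almost every $x,y\in B\cap\Omega$ and every ball $B$ with $|B|\le1$. (A2): there exist $\varphi_\infty\in\Phi_{\mathrm w}$, $h\in L^1(\Omega)\cap L^\infty(\Omega)$, $\beta\in(0,1]$ and $s>0$ such that, for almost every $x\in\Omega$, $\varphi(x,\beta t)\le\varphi_\infty(t)+h(x)$ whenever $\varphi_\infty(t)\in[0,s]$, and $\varphi_\infty(\beta t)\le\varphi(x,t)+h(x)$ whenever $\varphi(x,t)\in[0,s]$. Generalized Orlicz space: $L^\varphi(\Omega)$ is the set of measurable $f$ with $\int_\Omega\varphi(x,\lambda|f(x)|)\,dx<\infty$ for some $\lambda>0$, with the quasinorm $\|f\|_{L^\varphi(\Omega)}=\inf\{\lambda>0:\int_\Omega\varphi(x,|f(x)|/\lambda)\,dx\le1\}$. Maximal function: $Mf(x)=\sup_B\frac1{|B|}\int_{B\cap\Omega}|f(y)|\,dy$, the supremum being over all open balls $B\subset\mathbb{R}^n$ containing $x$. Boundedness of $M$ means that there is $K$ with $\|Mf\|_{L^\varphi(\Omega)}\le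 K\|f\|_{L^\varphi(\Omega)}$ for all $f\in L^\varphi(\Omega)$. *)

(* Defs.v *)
From HB Require Import structures.
From mathcomp Require Import all_boot all_order all_algebra.
From mathcomp Require Import all_classical all_reals all_analysis.
From mathcomp Require Import measurable_realfun.

Set Implicit Arguments.
Unset Strict Implicit.
Unset Printing Implicit Defensive.

Import Order.TTheory GRing.Theory Num.Theory.
Import numFieldNormedType.Exports.

Local Open Scope classical_set_scope.
Local Open Scope ring_scope.

(** R^n with n >= 1 is ['rV[R]_n.+1].  Lebesgue measure is the restriction of
    the outer measure built from half-open boxes to its Caratheodory-measurable
    sets, so [measurable] means Lebesgue measurable (not merely Borel), as for
    [completed_lebesgue_measure] on the line. *)

Section lebesgue_outer.
Context (R : realType) (n : nat).
Local Notation V := 'rV[R]_n.+1.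

Definition box (a b : V) : set V :=
  [set x | forall i, a ord0 i < x ord0 i <= b ord0 i].

Definition box_volume (a b : V) : R :=
  \prod_i Num.max 0 (b ord0 i - a ord0 i).

Definition box_cover (A : set V) : set ((V * V)^nat) :=
  [set c | A `<=` \bigcup_k box (c k).1 (c k).2].

Local Open Scope ereal_scope.

Definition lebesgue_outer (A : set V) : \bar R :=
  ereal_inf [set \sum_(k <oo) (box_volume (c k).1 (c k).2)%:E
            | c in box_cover A].

Lemma box_volume_ge0 (c : V * V) : 0 <= (box_volume c.1 c.2)%:E.
Proof. by rewrite lee_fin; apply: prodr_ge0 => i _; rewrite le_max lexx. Qed.

Let lebesgue_outer_ge0 A : 0 <= lebesgue_outer A.
Proof.
apply: le_ereal_inf_tmp => _ [c _ <-].
by apply: nneseries_ge0 => k _ _; exact: box_volume_ge0.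
Qed.

Let lebesgue_outer0 : lebesgue_outer set0 = 0.
Proof.
apply/eqP; rewrite eq_le lebesgue_outer_ge0 andbT.
apply: ereal_inf_lbound; exists (fun=> (0%R, 0%R)) => //=.
apply: eseries0 => k _ _.
by rewrite /box_volume big_ord_recl mxE subrr maxxx mul0r.
Qed.

Let le_lebesgue_outer : {homo lebesgue_outer : A B / A `<=` B >-> A <= B}.
Proof.
move=> A B AB; apply/ereal_inf_le_tmp => _ [c Bc <-].
by exists c => //; exact: subset_trans Bc.
Qed.

Let lebesgue_outer_sigma_subadditive : sigma_subadditive lebesgue_outer.
Proof.
move=> A; have [[i ioo]|] := pselect (exists i, lebesgue_outer (A i) = +oo).
  rewrite (eseries_pinfty _ _ ioo) ?leey// => k _.
  by rewrite -ltNye (lt_le_trans _ (lebesgue_outer_ge0 _)).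
rewrite -forallNE => Aoo.
suff add2e (e : {posnum R}) : lebesgue_outer (\bigcup_k A k) <=
    \sum_(i <oo) lebesgue_outer (A i) + e%:num%:E.
  by apply/lee_addgt0Pr => _/posnumP[].
have e0 : (0 <= e%:num)%R by [].
apply: le_trans (epsilon_trick xpredT (fun k => lebesgue_outer_ge0 (A k)) e0).
pose vol (c : V * V) := (box_volume c.1 c.2)%:E.
have vol0 c : 0 <= vol c by exact: box_volume_ge0.
pose P k (c : (V * V)^nat) := box_cover (A k) c /\
  \sum_(i <oo) vol (c i) <= lebesgue_outer (A k) + (e%:num / (2 ^ k.+1)%:R)%:E.
have [G PG] : {G : ((V * V)^nat)^nat & forall k, P k (G k)}.
  apply: (@choice _ _ P) => k.
  have fA : lebesgue_outer (A k) \is a fin_num.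
    by rewrite ge0_fin_numE ?lebesgue_outer_ge0// ltey; apply/eqP; exact: Aoo.
  have ek0 : (0 < e%:num / (2 ^ k.+1)%:R)%R by [].
  have [_ [c Ac <-] cA] := lb_ereal_inf_adherent ek0 fA.
  by exists c; split => //; exact: ltW.
have volG0 x : 0 <= (vol \o uncurry G) x by exact: vol0.
apply: (@le_trans _ _ (\esum_(i in setT) (vol \o uncurry G) i)).
  apply: ereal_inf_lbound => /=.
  have /card_esym/ppcard_eqP[f] := card_nat2.
  exists (uncurry G \o f).
    move=> t [i _ Ait]; have [j _ Gijt] := (PG i).1 _ Ait.
    by exists (f^-1%FUN (i, j)) => //=; rewrite invK ?inE.
  rewrite -(esum_pred_image (vol \o uncurry G) _ xpredT) ?[fun=> _]set_true//.
  by rewrite image_eq.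
rewrite (_ : esum _ _ = \sum_(i <oo) \sum_(j <oo) vol (G i j)); last first.
  pose J : nat -> set (nat * nat) := fun i => [set (i, j) | j in setT].
  rewrite (_ : setT = \bigcup_k J k); last first.
    by rewrite predeqE => -[a b]; split => // _; exists a => //; exists b.
  rewrite esum_bigcupT /=; last 2 first.
    - apply/trivIsetP => i j _ _ ij.
      rewrite predeqE => -[k m] /=; split => //= -[] [_] _ [<-{k} _].
      by move=> [m' _] [] /esym/eqP; rewrite (negbTE ij).
    - by move=> /= [k m]; exact: vol0.
  rewrite -(image_id [set: nat]) -fun_true esum_pred_image//; last first.
    by move=> k _; exact: esum_ge0.
  apply: eq_eseriesr => /= j _.
  rewrite -(esum_pred_image (vol \o uncurry G) (pair j) predT)//=; last first.
    by move=> ? ? _ _; exact: (@can_inj _ _ _ snd).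
  by congr esum; rewrite predeqE => -[a b]; split; move=> [i _ <-]; exists i.
apply: lee_nneseries => [k _ _|k _]; last exact: (PG k).2.
by apply: nneseries_ge0 => m _ _; exact: vol0.
Qed.

HB.instance Definition _ := isOuterMeasure.Build R V lebesgue_outer
  lebesgue_outer0 lebesgue_outer_ge0 le_lebesgue_outer
  lebesgue_outer_sigma_subadditive.

End lebesgue_outer.

(** Convertible to ['rV[R]_n.+1], but carries the Lebesgue sigma-algebra. *)
Definition euclidean (R : realType) (n : nat) :=
  caratheodory_type (@lebesgue_outer R n).

HB.instance Definition _ (R : realType) (n : nat) :=
  Measurable.on (euclidean R n).

Definition lebesgueRn (R : realType) (n : nat) : set (euclidean R n) -> \bar R :=
  @lebesgue_outer R n.

HB.instance Definition _ (R : realType) (n : nat) :=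
  isMeasure.Build _ (euclidean R n) R (@lebesgueRn R n)
    (@caratheodory_measure0 _ _ (@lebesgue_outer R n))
    (@caratheodory_measure_ge0 _ _ (@lebesgue_outer R n))
    (@caratheodory_measure_sigma_additive _ _ (@lebesgue_outer R n)).

Arguments lebesgueRn {R n} _.

Notation leb := (lebesgueRn : {measure set (euclidean _ _) -> \bar _}).

(** The library norm on ['rV[R]_n.+1] is the sup norm: it gives the usual
    topology but not the Euclidean balls and distances. *)

Section euclidean_geometry.
Context (R : realType) (n : nat).
Local Notation V := 'rV[R]_n.+1.

Definition l2norm (x : V) : R := Num.sqrt (\sum_i x ord0 i ^+ 2).

Definition l2ball (c : V) (r : R) : set V := [set y | l2norm (y - c) < r].

(** Equal to [+oo] when [A] is empty, so [shrink setT eps = setT]. *)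
Definition l2dist (x : V) (A : set V) : \bar R :=
  ereal_inf [set (l2norm (x - y))%:E | y in A].

Definition shrink (Omega : set V) (eps : R) : set V :=
  [set x | Omega x /\ (eps%:E < l2dist x (~` Omega))%E].

End euclidean_geometry.

(** A function phi : Omega x [0, oo) -> [0, oo] is represented by a total
    function; only its values at x in Omega and t >= 0 are constrained or used. *)

Section Phi_functions.
Context (R : realType) (n : nat).
Local Notation V := (euclidean R n).
Implicit Types (Omega A : set V) (phi : V -> R -> \bar R).

Local Open Scope ereal_scope.

Definition almost_increasing (L : R) (T : set R) (f : R -> \bar R) :=
  forall s t : R, T s -> T t -> (s < t)%R -> f s <= L%:E * f t.

Record Phi_w Omega phi : Prop := {
  Phi_w_ge0 : forall x (t : R), Omega x -> (0 <= t)%R -> 0 <= phi x t ;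
  Phi_w_measurable : forall f : V -> R, measurable_fun Omega f ->
    measurable_fun Omega ((fun x => phi x `|f x|%R) : V -> \bar R) ;
  Phi_w_nondecreasing : forall x (s t : R), Omega x -> (0 <= s)%R -> (s <= t)%R ->
    phi x s <= phi x t ;
  Phi_w_at0 : forall x, Omega x -> phi x 0%R = 0 ;
  Phi_w_cvg0 : forall x, Omega x -> phi x t @[t --> 0%R^'+] --> 0 ;
  Phi_w_cvgy : forall x, Omega x -> phi x t @[t --> +oo%R] --> +oo ;
  Phi_w_aInc1 : exists2 L : R, (1 <= L)%R & forall x, Omega x ->
    almost_increasing L [set t | (0 < t)%R] (fun t => phi x t / t%:E) }.

(** Required on the whole space, so that an empty [Omega] makes no difference. *)
Definition Phi_w_const (phi : R -> \bar R) := Phi_w setT (fun=> phi).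

Definition Phi_inv phi (x : V) (t : R) : \bar R :=
  ereal_inf [set tau%:E | tau in [set tau | (0 <= tau)%R /\ t%:E <= phi x tau]].

(** The exceptional null set does not depend on [s] and [t]. *)
Definition aInc (p : R) A (T : set R) phi :=
  exists2 a : R, (1 <= a)%R &
  {ae leb, forall x, A x -> forall s t : R, T s -> T t -> (0 < t)%R -> (t < s)%R ->
    phi x t / (t `^ p)%:E <= a%:E * (phi x s / (s `^ p)%:E)}.

Definition aInc_infty A phi :=
  exists p t0 : R, [/\ (1 < p)%R, (0 < t0)%R &
    aInc p A [set t | (t0 <= t)%R] phi].

Definition A0 Omega phi :=
  exists beta : R, [/\ (0 < beta)%R, (beta <= 1)%R &
  {ae leb, forall x, Omega x ->
    beta%:E <= Phi_inv phi x 1%R /\ Phi_inv phi x 1%R <= (beta^-1)%:E}].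

(** The exceptional null sets may depend on the ball, on [t] and, for [y],
    on [x]. *)
Definition A1 Omega phi :=
  exists beta : R, [/\ (0 < beta)%R, (beta < 1)%R &
  forall (c : V) (r : R), (0 < r)%R -> let B : set V := l2ball c r in
    leb B <= 1 ->
    forall t : R, (1 <= t)%R -> t%:E <= (leb B)^-1 ->
    {ae leb, forall x, B x -> Omega x ->
      {ae leb, forall y, B y -> Omega y ->
        beta%:E * Phi_inv phi x t <= Phi_inv phi y t}}].

Definition A2 Omega phi :=
  exists (phi_infty : R -> \bar R) (h : V -> R) (beta s : R),
  [/\ Phi_w_const phi_infty,
      h \_ Omega \in Lfun leb 1 /\ h \_ Omega \in Lfun leb +oo,
      (0 < beta <= 1)%R,
      (0 < s)%R &
  {ae leb, forall x, Omega x -> forall t : R, (0 <= t)%R ->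
    (0 <= phi_infty t <= s%:E ->
       phi x (beta * t)%R <= phi_infty t + (h x)%:E) /\
    (0 <= phi x t <= s%:E ->
       phi_infty (beta * t)%R <= phi x t + (h x)%:E)}].

(** phi(x, |y|) for an extended real y, with phi(x, oo) = oo: the maximal
   function of a function in L^phi may take the value +oo. *)
Definition Phi_abs phi (x : V) (y : \bar R) : \bar R :=
  if `|y| is r%:E then phi x r else +oo.

Definition modular Omega phi (f : V -> \bar R) : \bar R :=
  \int[leb]_(x in Omega) Phi_abs phi x (f x).

Definition Orlicz Omega phi : set (V -> R) :=
  [set f | measurable_fun Omega f /\
    exists2 lambda : R, (0 < lambda)%R &
      modular Omega phi (fun x => (lambda * f x)%:E) < +oo].

Definition Orlicz_norm Omega phi (f : V -> \bar R) : \bar R :=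
  ereal_inf [set lambda%:E | lambda in [set lambda : R |
    (0 < lambda)%R /\ modular Omega phi (fun x => f x / lambda%:E) <= 1]].

Definition maximal Omega (f : V -> R) (x : V) : \bar R :=
  ereal_sup [set (\int[leb]_(y in l2ball b.1 b.2 `&` Omega) `|f y|%:E)
                   / leb (l2ball b.1 b.2)
            | b in [set b : V * R | (0 < b.2)%R /\ l2ball b.1 b.2 x]].

Definition maximal_bounded Omega phi :=
  exists K : R, forall f, Orlicz Omega phi f ->
    Orlicz_norm Omega phi (maximal Omega f) <=
    K%:E * Orlicz_norm Omega phi (EFin \o f).

End Phi_functions.

(* Main.v *)
Require Import Defs.
From mathcomp Require Import all_boot all_order all_algebra.
From mathcomp Require Import all_classical all_reals all_analysis.
From mathcomp Require Import measurable_realfun.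
From mathcomp Require Import ring lra.

Set Implicit Arguments.
Unset Strict Implicit.
Unset Printing Implicit Defensive.

Import Order.TTheory GRing.Theory Num.Theory.
Import numFieldNormedType.Exports.

Local Open Scope classical_set_scope.
Local Open Scope ring_scope.

(** Write N = n.+1 and q = 2 ^ N, and let x be outside a suitable null set.

  The exponent p > 1 comes from a gain at one fixed scale: there is a jump
  A > 1, the same for all x in the shrunk domain and all large u, with
    phi(x, A u) >= 2 A phi(x, u).
  The function t |-> phi(x, t) / t thus at least doubles whenever t is
  multiplied by A, so iterating makes it grow like t ^ d with A ^ d = 2, up to a
  constant; the almost monotonicity of phi(x, t) / t fills the gaps between the
  scales A ^ k t ([geometric_scale], [aInc_of_jump]).

  The gain ([jump_growth]) is proved by contradiction.  If it fails at u, then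
  phi(x, .) is linear on [u, A u] up to factors independent of A.  Put
  M = phi(x, u) and take a bump of height about A u on a ball about x of volume
  about 1 / (A M): its modular is at most 1, since (A1) lets phi(y, .) be
  replaced by phi(x, .) for y in the ball.  On the dyadic ring of index j about
  the ball the maximal function is at least a multiple of q ^ -j A u, where phi
  is at least a multiple of q ^ -j A M, again by (A1); the volume of the ring is
  about q ^ j / (A M).  Each ring therefore adds the same fixed amount to the
  modular of the maximal function, and there are about log A / log q of them.
  As the maximal operator is bounded, A cannot be arbitrarily large.  The rings have to stay inside
  Omega, whence the distance eps to the boundary and a lower bound for phi(x, u),
  which (A0) supplies uniformly in x for large u.

  The measure theory has two difficulties.  (A1) speaks of almost every x and, for
  each such x, of almost every y, with exceptional sets depending on the ball
  and on t.  Balls with rational data and rational t suffice, and for these a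
  rational cut between the values at x and at y turns the nested quantifiers into
  a single null set ([ae_ae_le_negligible]); off that null set (A1) is
  symmetric in x and y, which matters because it is used in both directions
  ([A1_pointwise]).  The volume of balls is only needed up to scaling,
  [lebesgue_l2ball]; a null unit ball would make every set null and the theorem
  empty, so its volume may be taken positive. *)

(** * Lebesgue measure of Euclidean balls *)

Section lebesgue_measure_of_balls.
Context (R : realType) (n : nat).
Local Notation V := 'rV[R]_n.+1.
Local Notation mu := (leb : {measure set (euclidean R n) -> \bar R}).

Definition affine (c : V) (r : R) (x : V) : V := c + r *: x.

(** Such a map carries a cover by boxes to a cover by boxes and multiplies each
    volume by r ^ N. *)
Lemma lebesgue_outer_affine_le (c : V) (r : R) (A : set V) : 0 < r ->
  (lebesgue_outer (affine c r @` A) <= (r ^+ n.+1)%:E * lebesgue_outer A)%E.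
Proof.
move=> r0; have rN0 : 0 < r ^+ n.+1 by exact: exprn_gt0.
rewrite -lee_pdivrMl//; apply: le_ereal_inf_tmp => _ [cov covA <-].
rewrite lee_pdivrMl// -nneseriesZl; last by move=> *; exact: box_volume_ge0.
apply: ereal_inf_lbound.
exists (fun k => (affine c r (cov k).1, affine c r (cov k).2)).
  move=> _ [x Ax <-]; have [k _ kx] := covA _ Ax; exists k => //= i.
  have := kx i; rewrite /affine !mxE /=.
  by rewrite ltrD2l lerD2l ltr_pM2l// ler_pM2l.
apply: eq_eseriesr => k _ /=; rewrite -EFinM; congr (_%:E).
have -> : r ^+ n.+1 = \prod_(i < n.+1) r by rewrite prodr_const card_ord.
rewrite /box_volume -big_split /=.
apply: eq_bigr => i _; rewrite /affine !mxE.
by rewrite maxr_pMr ?ltW// mulr0; congr (Num.max _ _); ring.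
Qed.

(** The reverse inequality is [lebesgue_outer_affine_le] for the inverse map. *)
Lemma lebesgue_outer_affine (c : V) (r : R) (A : set V) : 0 < r ->
  (lebesgue_outer (affine c r @` A) = (r ^+ n.+1)%:E * lebesgue_outer A)%E.
Proof.
move=> r0; apply/eqP; rewrite eq_le lebesgue_outer_affine_le//=.
have rN0 : 0 < r ^+ n.+1 by exact: exprn_gt0.
rewrite -lee_pdivlMl// -exprVn.
have r'0 : 0 < r^-1 by rewrite invr_gt0.
apply: le_trans (lebesgue_outer_affine_le (- (r^-1 *: c)) _ r'0).
apply: le_outer_measure => x Ax; exists (affine c r x); first by exists x.
rewrite /affine scalerDr addrA addNr add0r scalerA mulVf ?gt_eqF//.
by rewrite scale1r.
Qed.

Lemma l2norm_sym (x y : V) : l2norm (x - y) = l2norm (y - x).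
Proof.
rewrite /l2norm; congr Num.sqrt; apply: eq_bigr => i _.
by rewrite !mxE -sqrrN opprB.
Qed.

Lemma l2normZ (r : R) (x : V) : 0 <= r -> l2norm (r *: x) = r * l2norm x.
Proof.
move=> r0; rewrite /l2norm.
under eq_bigr do rewrite !mxE exprMn.
by rewrite -mulr_sumr sqrtrM ?sqr_ge0// sqrtr_sqr ger0_norm.
Qed.

Lemma l2ball_affine (c : V) (r : R) : 0 < r ->
  l2ball c r = affine c r @` l2ball 0 1.
Proof.
move=> r0; apply/seteqP; split => [y yr|_ [x x1 <-]].
  exists (r^-1 *: (y - c)).
    by rewrite /l2ball /= subr0 l2normZ ?invr_ge0 ?ltW// mulrC ltr_pdivrMr// mul1r.
  by rewrite /affine scalerA mulfV ?gt_eqF// scale1r addrC subrK.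
move: x1; rewrite /l2ball /= subr0 /affine addrC addKr => x1.
by rewrite l2normZ ?ltW// gtr_pMr.
Qed.

Lemma lebesgue_l2ball (c : V) (r : R) : 0 < r ->
  (mu (l2ball c r) = (r ^+ n.+1)%:E * mu (l2ball 0 1))%E.
Proof. by move=> r0; rewrite (l2ball_affine c r0); exact: lebesgue_outer_affine. Qed.

Lemma abs_coord_le_l2norm (x : V) i : `|x ord0 i| <= l2norm x.
Proof.
rewrite -sqrtr_sqr /l2norm ler_wsqrtr// (bigD1 i)//= lerDl.
by apply: sumr_ge0 => j _; exact: sqr_ge0.
Qed.

Lemma lebesgue_l2ball_fin : (mu (l2ball (0 : V) 1) < +oo)%E.
Proof.
pose cov (k : nat) : V * V :=
  if k is 0 then (const_mx (-1), const_mx 1) else (0, 0).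
have s0 : box_cover (l2ball (0 : V) 1) cov.
  move=> x x1; exists 0%N => //= i; rewrite !mxE.
  have xi : `|x ord0 i| < 1.
    by apply: le_lt_trans (abs_coord_le_l2norm x i) _; move: x1; rewrite /l2ball/= subr0.
  by move: xi; rewrite ltr_norml => /andP[-> /ltW ->].
apply: (@le_lt_trans _ _ (box_volume (const_mx (-1) : V) (const_mx 1))%:E);
  last by rewrite ltry.
apply: ge_ereal_inf.
exists (\sum_(k <oo) (box_volume (cov k).1 (cov k).2)%:E)%E; first by exists cov.
rewrite (nneseries_split 0%N 1%N)//; last by move=> k _; exact: box_volume_ge0.
rewrite big_nat1 add0n eseries0 ?adde0//= => -[//|k] _ _ /=.
by rewrite /box_volume big_ord_recl mxE subrr maxxx mul0r.
Qed.

Definition set_coord (x : V) (i : 'I_n.+1) (a : R) : V :=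
  \row_j if j == i then a else x ord0 j.

(** The hyperplane x_i = a cuts a box into two boxes; when it misses the box,
    one of the two is degenerate and has volume 0. *)
Lemma box_volume_split (l u : V) (i : 'I_n.+1) (a : R) :
  box_volume l (set_coord u i (Num.min (u ord0 i) a)) +
  box_volume (set_coord l i (Num.max (l ord0 i) a)) u = box_volume l u.
Proof.
have volE (x y : V) : box_volume x y = Num.max 0 (y ord0 i - x ord0 i) *
    \prod_(j | j != i) Num.max 0 (y ord0 j - x ord0 j).
  by rewrite /box_volume (bigD1 i).
rewrite !volE !mxE eqxx.
under eq_bigr => j /negbTE ji do rewrite !mxE ji.
under [X in _ + _ * X]eq_bigr => j /negbTE ji do rewrite !mxE ji.
rewrite -mulrDl; congr (_ * _).
rewrite !maxEle !minEle.
by do ! case: ifPn => //; rewrite -?ltNge; lra.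
Qed.

(** Splitting every box of a cover of X along the hyperplane gives covers of the
    two parts of X with the same total volume: Caratheodory's criterion. *)
Lemma measurable_halfspace (i : 'I_n.+1) (a : R) :
  measurable ([set x | x ord0 i <= a] : set (euclidean R n)).
Proof.
apply: le_caratheodory_measurable => X.
apply: le_ereal_inf_tmp => _ [cov covX <-].
pose cov1 k := ((cov k).1,
  set_coord (cov k).2 i (Num.min ((cov k).2 ord0 i) a)).
pose cov2 k := (set_coord (cov k).1 i (Num.max ((cov k).1 ord0 i) a),
  (cov k).2).
have -> : (\sum_(k <oo) (box_volume (cov k).1 (cov k).2)%:E =
    \sum_(k <oo) (box_volume (cov1 k).1 (cov1 k).2)%:E +
    \sum_(k <oo) (box_volume (cov2 k).1 (cov2 k).2)%:E)%E.
  rewrite -nneseriesD; try by move=> *; exact: box_volume_ge0.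
  by apply: eq_eseriesr => k _; rewrite -EFinD box_volume_split.
apply: leeD; apply: ereal_inf_lbound; [exists cov1|exists cov2] => //.
  move=> x [/covX[k _ kx] /= xa]; exists k => // j /=.
  rewrite mxE; have /andP[-> xu] /= := kx j.
  by case: eqP xu => // -> xu; rewrite le_min xu.
move=> x [/covX[k _ kx] /= /negP]; rewrite -ltNge => xa; exists k => // j /=.
rewrite mxE; have /andP[xl ->] := kx j; rewrite andbT.
by case: eqP xl => // -> xl; rewrite gt_max xl.
Qed.

Lemma measurable_coord (i : 'I_n.+1) :
  measurable_fun setT ((fun x => x ord0 i) : euclidean R n -> R).
Proof.
apply: (measurability _ (RGenOInfty.measurableE R)) => // _ [_ [r ->] <-].
rewrite setTI.
rewrite [X in measurable X](_ : _ =
    ~` [set x : euclidean R n | x ord0 i <= r]); last first.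
  by apply/seteqP; split => x /=; rewrite in_itv/= andbT ltNge => /negP.
by apply: measurableC; exact: measurable_halfspace.
Qed.

Lemma l2norm_ltE (c y : V) (r : R) : 0 < r ->
  (l2norm (y - c) < r) = (\sum_i (y ord0 i - c ord0 i) ^+ 2 < r ^+ 2).
Proof.
move=> r0; rewrite /l2norm.
have -> : \sum_i (y - c) ord0 i ^+ 2 = \sum_i (y ord0 i - c ord0 i) ^+ 2.
  by apply: eq_bigr => i _; rewrite !mxE.
by rewrite -[X in _ < X]ger0_norm ?ltW// -sqrtr_sqr ltr_sqrt ?exprn_gt0.
Qed.

Lemma measurable_l2ball (c : V) (r : R) :
  measurable (l2ball c r : set (euclidean R n)).
Proof.
have [r0|r0] := ltP 0 r; last first.
  rewrite (_ : l2ball c r = set0) ?measurable0// -subset0 => x /=.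
  by rewrite /l2ball /= ltNge (le_trans r0)// sqrtr_ge0.
pose d (i : 'I_n.+1) : euclidean R n -> R := fun x => x ord0 i.
have md : measurable_fun setT (fun x => \sum_i (d i x - c ord0 i) ^+ 2).
  apply: measurable_sum => i; apply: measurable_funX.
  exact: measurable_funB (measurable_coord i) (measurable_cst _).
have := md measurableT _ (measurable_itv `]-oo, r ^+ 2[).
rewrite setTI; congr (measurable _); apply/funext => x; apply/propext.
by rewrite /l2ball /= l2norm_ltE.
Qed.

End lebesgue_measure_of_balls.

(** * Nested almost-everywhere statements *)

Section almost_everywhere.
Context (d : measure_display) (T : measurableType d) (R : realType).
Context (mu : {measure set T -> \bar R}).

Lemma negligible_bigcup_countable (I : countType) (F : I -> set T) :
  (forall i, mu.-negligible (F i)) -> mu.-negligible (\bigcup_i F i).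
Proof.
move=> F0; pose G k := if unpickle k is Some i then F i else set0.
have G0 k : mu.-negligible (G k).
  by rewrite /G; case: unpickle => // ; exact: negligible_set0.
apply: negligibleS (negligible_bigcup G0) => x [i _ Fix].
by exists (pickle i) => //; rewrite /G pickleK.
Qed.

Lemma ereal_rat_between (a b : \bar R) : (a < b)%E ->
  exists q : rat, (a < (ratr q)%:E)%E /\ ((ratr q)%:E < b)%E.
Proof.
case: a b => [a| |] [b| |] //.
- by rewrite lte_fin => /rat_in_itvoo[q]; rewrite in_itv/= => /andP[? ?]; exists q.
- move=> _; have /rat_in_itvoo[q] : a < a + 1 by rewrite ltrDl.
  by rewrite in_itv/= => /andP[? _]; exists q; rewrite lte_fin ltry.
- move=> _; have /rat_in_itvoo[q] : b - 1 < b by rewrite ltrBlDr ltrDl.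
  by rewrite in_itv/= => /andP[_ ?]; exists q; rewrite lte_fin ltNyr.
- by move=> _; exists 0; rewrite ltNyr ltry.
Qed.

(** For a rational q such that q < b x for some good x, almost every y satisfies
    q <= g y.  Discarding the exceptional y of these countably many q leaves no
    room for a rational between g y and b x.  Exchanging the two quantifiers by
    Fubini's theorem is no option: the set of pairs (x, y) with b x <= g y need
    not be measurable. *)
Lemma ae_ae_le_negligible (D : set T) (b g : T -> \bar R) :
  {ae mu, forall x, D x -> {ae mu, forall y, D y -> (b x <= g y)%E}} ->
  exists2 E : set T, mu.-negligible E &
    forall x y, D x -> D y -> ~ E x -> ~ E y -> (b x <= g y)%E.
Proof.
set G := [set x | D x -> {ae mu, forall y, D y -> (b x <= g y)%E}] => GE.
pose E (q : rat) : set T := [set y | [/\ D y, (g y < (ratr q)%:E)%E &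
  exists x, [/\ D x, G x & ((ratr q)%:E < b x)%E]]].
have E0 q : mu.-negligible (E q).
  have [[x [Dx Gx qx]]|noq] :=
      pselect (exists x, [/\ D x, G x & ((ratr q)%:E < b x)%E]); last first.
    by apply: negligibleS (negligible_set0 mu) => y [_ _ /noq].
  apply: negligibleS (Gx Dx) => y [Dy gy _] /= /(_ Dy).
  by rewrite leNgt (lt_trans gy qx).
exists (~` G `|` \bigcup_q E q).
  by apply: negligibleU => //; exact: negligible_bigcup_countable.
move=> x y Dx Dy Ex Ey; rewrite leNgt; apply/negP => /ereal_rat_between[q [gq qb]].
apply: Ey; right; exists q => //; split=> //; exists x; split=> //.
by apply: contrapT => Gx; apply: Ex; left.
Qed.

(** Monotonicity without measurability: the integral of a nonnegative function is
    by definition a supremum over the simple functions below it. *)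
Lemma le_integral_restrict (D E : set T) (f g : T -> \bar R) :
  (forall x, D x -> 0 <= f x)%E -> (forall x, E x -> 0 <= g x)%E ->
  (forall x, (f \_ D) x <= (g \_ E) x)%E ->
  (\int[mu]_(x in D) f x <= \int[mu]_(x in E) g x)%E.
Proof.
move=> f0 g0 fg; rewrite !ge0_integralE//; apply: le_ereal_sup => _ [h hf <-].
by exists h => // x; exact: le_trans (hf x) (fg x).
Qed.

End almost_everywhere.

(** * Rational centres *)

Section rational_points.
Context (R : realType) (n : nat).
Local Notation V := 'rV[R]_n.+1.

(** With u = y - x and v = c - x, the square of a coordinate of y - c is
    (u - v)^2 <= u^2 + (2|u| + 1) e as soon as |v| < e <= 1. *)
Lemma l2norm_near (x y : V) (rho : R) : 0 < rho -> l2norm (y - x) < rho ->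
  exists2 d : R, 0 < d &
    forall c : V, (forall i, `|c ord0 i - x ord0 i| < d) -> l2norm (y - c) < rho.
Proof.
move=> rho0; rewrite l2norm_ltE// => yx.
set S := \sum_i _ in yx.
pose C := 1 + \sum_i (2 * `|y ord0 i - x ord0 i| + 1).
have C1 : 1 <= C by rewrite lerDl; apply: sumr_ge0 => i _; rewrite addr_ge0// mulr_ge0.
have C0 : 0 < C by exact: lt_le_trans C1.
pose e := Num.min 1 ((rho ^+ 2 - S) / C).
have e0 : 0 < e by rewrite lt_min ltr01 divr_gt0// subr_gt0.
have eC : e * C <= rho ^+ 2 - S by rewrite -ler_pdivlMr// ge_min lexx orbT.
have e1 : e <= 1 by rewrite ge_min lexx.
exists e => // c cx; rewrite l2norm_ltE//.
apply: (@le_lt_trans _ _ (S + e * (C - 1))); last by lra.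
have -> : C - 1 = \sum_i (2 * `|y ord0 i - x ord0 i| + 1) by rewrite /C addrC addKr.
rewrite mulr_sumr -big_split /=; apply: ler_sum => i _.
have := cx i; set u := y ord0 i - x ord0 i; set v := c ord0 i - x ord0 i => ve.
have -> : y ord0 i - c ord0 i = u - v by rewrite /u /v; ring.
have uv : - (2 * (u * v)) <= 2 * (`|u| * `|v|).
  by rewrite -normrM -mulrN ler_wpM2l// -normrN ler_norm.
have v2 : v ^+ 2 <= e.
  rewrite -real_normK ?num_real// expr2.
  apply: (@le_trans _ _ (e * e)); first by apply: ler_pM => //; exact: ltW.
  by rewrite ler_piMl// ltW.
have ue : `|u| * `|v| <= `|u| * e by rewrite ler_wpM2l// ltW.
rewrite sqrrB -mulr_natl; lra.
Qed.

Definition rat_point (c : 'rV[rat]_n.+1) : V := map_mx ratr c.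

Lemma rat_point_near (x y : V) (rho : R) : l2norm (x - y) < rho ->
  exists c : 'rV[rat]_n.+1, l2ball (rat_point c) rho x /\ l2ball (rat_point c) rho y.
Proof.
move=> xy; have rho0 : 0 < rho by exact: le_lt_trans (sqrtr_ge0 _) xy.
have xx : l2norm (x - x) < rho.
  rewrite subrr /l2norm; under eq_bigr do rewrite mxE expr0n /=.
  by rewrite big1// sqrtr0.
have [d1 d10 near1] := l2norm_near rho0 xx.
have [d2 d20 near2] : exists2 d : R, 0 < d &
    forall c : V, (forall i, `|c ord0 i - x ord0 i| < d) -> l2norm (y - c) < rho.
  by apply: l2norm_near => //; rewrite l2norm_sym.
pose d := Num.min d1 d2; have d0 : 0 < d by rewrite lt_min d10.
have /choice[c cx] : forall i, exists q : rat, `|ratr q - x ord0 i| < d.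
  move=> i; have /rat_in_itvoo[q] : x ord0 i - d < x ord0 i + d by lra.
  by rewrite in_itv/= => xq; exists q; rewrite ltr_distl.
exists (\row_i c i); split; [apply: near1|apply: near2] => i; rewrite !mxE;
  by apply: lt_le_trans (cx i) _; rewrite ge_min lexx ?orbT.
Qed.

End rational_points.

(** * Pointwise forms of (A0) and (A1) *)

Section pointwise_conditions.
Context (R : realType) (n : nat) (Omega : set 'rV[R]_n.+1).
Context (phi : 'rV[R]_n.+1 -> R -> \bar R) (Pw : Phi_w Omega phi).
Local Notation V := 'rV[R]_n.+1.
Local Notation mu := (leb : {measure set (euclidean R n) -> \bar R}).

Lemma lt_Phi_inv (x : V) (s t : R) : 0 <= s -> (s%:E < Phi_inv phi x t)%E ->
  (phi x s < t%:E)%E.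
Proof.
move=> s0; apply: contraTT; rewrite -!leNgt => ts.
by apply: ereal_inf_lbound; exists s.
Qed.

Lemma le_Phi_inv (x : V) (s t : R) : Omega x -> (phi x s < t%:E)%E ->
  (s%:E <= Phi_inv phi x t)%E.
Proof.
move=> Ox st; apply: le_ereal_inf_tmp => _ [tau [tau0 ttau] <-].
rewrite lee_fin leNgt; apply/negP => taus.
have := Phi_w_nondecreasing Pw Ox tau0 (ltW taus).
by rewrite leNgt (lt_le_trans st).
Qed.

Lemma A0_pointwise : A0 Omega phi ->
  exists2 u0 : R, 0 < u0 & {ae mu, forall x, Omega x -> (1%:E <= phi x u0)%E}.
Proof.
move=> [b [b0 _ bae]]; exists (2 / b); first by rewrite divr_gt0.
apply: filterS bae => x xb Ox; have [_ xb1] := xb Ox.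
rewrite leNgt; apply/negP => /(le_Phi_inv Ox) /le_trans /(_ xb1).
by rewrite lee_fin ler_pdivrMr// mulVf ?gt_eqF//; lra.
Qed.

(** (A1) stated for phi instead of its inverse, at all points off one null set and
    for all real data.  The factor 2 in front of rho leaves room for a ball with
    rational centre and radius that contains both points, and the inequality
    phi x s < T, being strict, leaves room for a rational level.  Used with x and y exchanged
    and contraposed, it also bounds phi from below. *)
Lemma A1_pointwise (w : R) : 0 < w -> mu (l2ball 0 1) = w%:E -> A1 Omega phi ->
  exists b : R, [/\ 0 < b, b < 1 & exists2 E : set V, mu.-negligible E &
    forall x y (rho T s s' : R), Omega x -> Omega y -> ~ E x -> ~ E y ->
      l2norm (x - y) < rho -> 1 < T -> T * (w * (2 * rho) ^+ n.+1) <= 1 ->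
      0 <= s' -> s' < b * s ->
      (phi x s < T%:E)%E -> (phi y s' < T%:E)%E].
Proof.
move=> w0 wE [b [b0 b1 A1b]]; exists b; split => //.
pose ball_of (i : 'rV[rat]_n.+1 * rat * rat) : set V :=
  l2ball (rat_point R i.1.1) (ratr i.1.2).
pose admissible (i : 'rV[rat]_n.+1 * rat * rat) :=
  [/\ 0 < (ratr i.1.2 : R), (mu (ball_of i) <= 1)%E, 1 <= (ratr i.2 : R) &
    ((ratr i.2)%:E <= (mu (ball_of i))^-1)%E].
have /choice[E E_] : forall i, exists E : set V, mu.-negligible E /\
    (admissible i -> forall x y, ball_of i x -> Omega x -> ball_of i y -> Omega y ->
      ~ E x -> ~ E y ->
      (b%:E * Phi_inv phi x (ratr i.2) <= Phi_inv phi y (ratr i.2))%E).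
  move=> i; have [[r0 B1 t1 tB]|nadm] := pselect (admissible i); last first.
    by exists set0; split => //; exact: negligible_set0.
  have [|E E0 Ele] := @ae_ae_le_negligible _ _ _ mu (ball_of i `&` Omega)
      (fun x => b%:E * Phi_inv phi x (ratr i.2))%E
      (fun x => Phi_inv phi x (ratr i.2)).
    have := A1b _ _ r0 B1 _ t1 tB; apply: filterS => x xae [Bx Ox].
    by apply: filterS (xae Bx Ox) => y yle [By Oy]; exact: yle.
  by exists E; split => // _ x y Bx Ox By Oy; exact: Ele.
exists (\bigcup_i E i).
  by apply: negligible_bigcup_countable => i; exact: (E_ i).1.
move=> x y rho T s s' Ox Oy Ex Ey xy T1 Trho s'0 s's xs.
have rho0 : 0 < rho by apply: le_lt_trans xy; exact: sqrtr_ge0.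
have [c [cx cy]] := rat_point_near xy.
have /rat_in_itvoo[r] : rho < 2 * rho by lra.
rewrite in_itv/= => /andP[rho_r r_2rho].
have r0 : 0 < (ratr r : R) by exact: lt_trans rho_r.
have [t [st tT]] : exists t : rat,
    (maxe 1 (phi x s) < (ratr t)%:E)%E /\ ((ratr t)%:E < T%:E)%E.
  by apply: ereal_rat_between; rewrite gt_max lte_fin T1.
move: st; rewrite gt_max lte_fin => /andP[t1 st].
set q := (c, r, t).
have muB : mu (ball_of q) = ((ratr r) ^+ n.+1 * w)%:E.
  by rewrite lebesgue_l2ball// wE.
have rw0 : 0 < (ratr r) ^+ n.+1 * w by rewrite mulr_gt0// exprn_gt0.
have tw : ratr t * ((ratr r) ^+ n.+1 * w) <= 1.
  apply: le_trans Trho; rewrite [X in ratr t * X]mulrC.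
  apply: ler_pM => //.
  - by rewrite ltW// (lt_trans ltr01).
  - by rewrite mulr_ge0 ?ltW// exprn_gt0.
  - by move: tT; rewrite lte_fin => /ltW.
  - by rewrite ler_pM2l// lerXn2r ?nnegrE ?ltW// (lt_trans r0).
have adm : admissible q.
  split => //=; [|exact: ltW|].
  - rewrite muB lee_fin; apply: le_trans tw.
    by rewrite ler_peMl// ltW.
  - by rewrite muB inver gt_eqF// lee_fin -div1r ler_pdivlMr.
have in_ball z : l2ball (rat_point R c) rho z -> ball_of q z.
  by rewrite /l2ball /= => /lt_trans; apply.
have nE z : ~ (\bigcup_i E i) z -> ~ E q z by move=> Ez Eqz; apply: Ez; exists q.
have := (E_ q).2 adm x y (in_ball _ cx) Ox (in_ball _ cy) Oy (nE _ Ex) (nE _ Ey).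
move=> xyle; apply: lt_trans tT; apply: lt_Phi_inv => //.
apply: lt_le_trans xyle; apply: (@lt_le_trans _ _ (b * s)%:E); first by rewrite lte_fin.
by rewrite EFinM lee_pmul2l//; exact: le_Phi_inv.
Qed.

End pointwise_conditions.

(** * Bounds for integrals and the maximal function of a bump *)

Section integral_bounds.
Context (d : measure_display) (T : measurableType d) (R : realType).
Context (mu : {measure set T -> \bar R}).

Lemma integral_supported_le (D B E : set T) (f : T -> \bar R) (a : R) :
  0 <= a -> measurable B -> mu.-negligible E ->
  (forall x, D x -> 0 <= f x)%E ->
  (forall x, D x -> ~ B x -> f x = 0%E) ->
  (forall x, D x -> B x -> ~ E x -> f x <= a%:E)%E ->
  (\int[mu]_(x in D) f x <= a%:E * mu B)%E.
Proof.
move=> a0 mB [N [mN N0 EN]] f0 fB fa.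
(* On the null set the majorant is infinite, which costs nothing. *)
pose g x := ((cst a%:E \_ B) x + (cst +oo \_ N) x)%E.
have gB0 x : (0 <= (cst a%:E \_ B) x)%E.
  by rewrite patchE; case: ifPn => //; rewrite lee_fin.
have gN0 x : (0 <= (cst +oo \_ N) x :> \bar R)%E.
  by rewrite patchE; case: ifPn => //=; rewrite leey.
have g0 x : (0 <= g x)%E by rewrite adde_ge0.
apply: (@le_trans _ _ (\int[mu]_(x in setT) g x)%E).
  apply: le_integral_restrict => // x; rewrite patch_setT patchE.
  case: ifPn => [/set_mem Dx|_]; last exact: g0.
  have [Nx|Nx] := pselect (N x).
    rewrite /g [(cst +oo%E \_ N) x]patchE mem_set//= addey ?leey//.
    by rewrite gt_eqF// (lt_le_trans _ (gB0 x)) ?ltNyr.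
  have [Bx|Bx] := pselect (B x); last by rewrite fB.
  rewrite /g patchE mem_set//=; apply: le_trans (leeDl _ (gN0 x)).
  by apply: fa => // /EN.
rewrite ge0_integralD//; last 2 first.
- by apply/(measurable_restrictT _ mB); exact: measurable_cst.
- by apply/(measurable_restrictT _ mN); exact: measurable_cst.
rewrite -!integral_mkcond !integral_cst// N0 mule0 adde0.
exact: lexx.
Qed.

Lemma sum_le_integral (J : nat) (D : set T) (F : 'I_J -> set T) (E : set T)
    (f : T -> \bar R) (a : 'I_J -> R) :
  (forall j, 0 <= a j) -> (forall j, measurable (F j)) -> trivIset setT F ->
  mu.-negligible E -> (forall j, F j `<=` D) ->
  (forall x, D x -> 0 <= f x)%E ->
  (forall j x, F j x -> ~ E x -> (a j)%:E <= f x)%E ->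
  (\sum_(j < J) (a j)%:E * mu (F j) <= \int[mu]_(x in D) f x)%E.
Proof.
move=> a0 mF tF [N [mN N0 EN]] FD f0 fa.
pose G j := F j `\` N.
have mG j : measurable (G j) by exact: measurableD.
have muG j : (mu (F j) <= mu (G j))%E.
  rewrite -[leRHS]adde0 -N0; apply: le_trans (measureU2 _ _ _) => //.
  apply: le_measure; rewrite ?inE//; first exact: measurableU.
  by move=> x Fx; have [Nx|Nx] := pselect (N x); [right|left].
pose g x := (\sum_(j < J) (cst (a j)%:E \_ (G j)) x)%E.
have ga0 j x : (0 <= (cst (a j)%:E \_ (G j)) x)%E.
  by rewrite patchE; case: ifPn => //; rewrite lee_fin.
have g0 x : (0 <= g x)%E by apply: sume_ge0 => j _; exact: ga0.
apply: (@le_trans _ _ (\int[mu]_(x in setT) g x)%E).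
  rewrite ge0_integral_sum//; last first.
    by move=> j; apply/(measurable_restrictT _ (mG j)); exact: measurable_cst.
  apply: lee_sum => j _; rewrite -integral_mkcond integral_cst//.
  by rewrite lee_wpmul2l ?lee_fin.
apply: le_integral_restrict => // x; rewrite patch_setT /g.
have [[j [Fx Nx]]|noj] := pselect (exists j, G j x).
  rewrite (bigD1 j)//= big1 ?adde0; last first.
    move=> i ij; rewrite patchE; case: ifPn => // /set_mem[Fix _].
    by rewrite (tF i j) ?eqxx// in ij; exists x.
  rewrite !patchE !mem_set//; first by apply: fa Fx _ => /EN.
  exact: FD Fx.
rewrite big1; first by rewrite patchE; case: ifPn => // /set_mem/f0.
move=> j _; rewrite patchE; case: ifPn => // /set_mem Gx.
by exfalso; apply: noj; exists j.
Qed.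

End integral_bounds.

Section test_functions.
Context (R : realType) (n : nat) (Omega : set (euclidean R n)).
Local Notation V := 'rV[R]_n.+1.
Local Notation mu := (leb : {measure set (euclidean R n) -> \bar R}).

Definition bump (s : R) (x : V) (r : R) : V -> R := fun y => s * \1_(l2ball x r) y.

Lemma measurable_bump s x r :
  measurable_fun Omega (bump s x r : euclidean R n -> R).
Proof.
apply: (@measurable_funM _ (euclidean R n) _ _ (cst s)).
  exact: measurable_cst.
exact: measurable_indic (measurable_l2ball x r).
Qed.

(** The concentric ball of radius r' is itself one of the averaging balls for y. *)
Lemma maximal_bump_ge (s : R) (x y : V) (r r' : R) : 0 <= s -> 0 < r' -> r <= r' ->
  l2ball x r `<=` Omega -> l2ball x r' y ->
  (s%:E * mu (l2ball x r) / mu (l2ball x r') <= maximal Omega (bump s x r) y)%E.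
Proof.
move=> s0 r'0 rr' BO B'y; apply: ereal_sup_ubound; exists (x, r') => //=.
congr (_ / _)%E.
pose B : set (euclidean R n) := l2ball x r.
rewrite (eq_integral (cst s%:E \_ B)); last first.
  move=> z _; rewrite patchE /bump indicE; case: ifPn => _ /=.
    by rewrite mulr1 ger0_norm.
  by rewrite mulr0 normr0.
rewrite -integral_mkcondr (_ : _ `&` _ = B).
  by rewrite integral_cst//; exact: measurable_l2ball.
apply/seteqP; split => [z []//|z Bz]; split => //; split; last exact: BO.
by move: Bz; rewrite /l2ball /= => /lt_le_trans; apply.
Qed.

End test_functions.

(** * Growth of weak Phi-functions and the modular form of boundedness *)

Section Phi_growth.
Context (R : realType) (n : nat) (Omega : set (euclidean R n)).
Context (phi : 'rV[R]_n.+1 -> R -> \bar R) (Pw : Phi_w Omega phi).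
Local Notation V := 'rV[R]_n.+1.

Lemma almost_increasing_growth (L : R) (x : V) (M s t : R) : 1 <= L ->
  almost_increasing L [set t | 0 < t] (fun t => phi x t / t%:E)%E ->
  0 < s -> s <= t -> 0 <= M -> (M%:E <= phi x s)%E ->
  Omega x -> ((M * (t / s) / L)%:E <= phi x t)%E.
Proof.
move=> L1 incL s0 st M0 Ms Ox.
have L0 : 0 < L by exact: lt_le_trans L1.
have t0 : 0 < t by exact: lt_le_trans st.
have phi0 r : 0 < r -> (0 <= phi x r)%E.
  by move=> /ltW r0; exact: Phi_w_ge0 Pw _ _ Ox r0.
have := st; rewrite le_eqVlt => /orP[/eqP <-|s_t].
  apply: le_trans Ms; rewrite lee_fin divff ?gt_eqF// mulr1.
  by rewrite ler_pdivrMr// ler_peMr.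
have := incL _ _ s0 t0 s_t; have := Phi_w_nondecreasing Pw Ox (ltW s0) st.
move: (phi0 _ s0) (phi0 _ t0) Ms.
case: (phi x s) => [c| |] //; case: (phi x t) => [e| |] // c0 e0 Mc ce.
  rewrite !inver !gt_eqF// -!EFinM !lee_fin => cL.
  rewrite lee_fin in Mc; rewrite ler_pdivrMr// mulrA ler_pdivrMr//.
  have : c / s * (s * t) <= L * (e / t) * (s * t) by rewrite ler_wpM2r// mulr_ge0// ltW.
  rewrite mulrA divfK ?gt_eqF// => h.
  have -> : e * L * s = L * (e / t) * (s * t) by field; rewrite gt_eqF.
  by apply: le_trans h; rewrite ler_wpM2r// ltW.
all: by rewrite ?leey.
Qed.

Lemma Phi_abs_ge (y : V) (s : R) (z : \bar R) : Omega y -> 0 <= s ->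
  (s%:E <= z)%E -> (phi y s <= Phi_abs phi y z)%E.
Proof.
move=> Oy s0; rewrite /Phi_abs; case: z => [z| |] /=; rewrite ?leey//.
rewrite lee_fin => sz; rewrite ger0_norm ?(le_trans s0)//.
exact: Phi_w_nondecreasing Pw _ _ _ Oy s0 sz.
Qed.

Lemma Phi_abs_ge0 (y : V) (z : \bar R) : Omega y -> (0 <= Phi_abs phi y z)%E.
Proof.
by move=> Oy; rewrite /Phi_abs; case: z => [z| |] /=; rewrite ?leey// (Phi_w_ge0 Pw).
Qed.

(** Boundedness on the unit ball of the space, as an inequality between modulars.
    The infimum defining the norm need not be attained, hence a constant strictly
    larger than the operator norm; taking it at least 1 gives it a sign. *)
Lemma maximal_bounded_modular : maximal_bounded Omega phi ->
  exists2 K : R, 1 <= K & forall f : V -> R,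
    measurable_fun Omega (f : euclidean R n -> R) ->
    (modular Omega phi (EFin \o f) <= 1)%E ->
    exists l : R, [/\ 0 < l, l <= K &
      (modular Omega phi (fun x => maximal Omega f x / l%:E) <= 1)%E].
Proof.
move=> [K bndK]; exists (Num.max K 1 + 1).
  by rewrite lerDr le_max ler01 orbT.
move=> f mf f1.
have fO : Orlicz Omega phi f.
  split => //; exists 1 => //.
  under [X in modular _ _ X]eq_fun do rewrite mul1r.
  exact: le_lt_trans f1 (ltry _).
have norm1 : (Orlicz_norm Omega phi (EFin \o f) <= 1)%E.
  apply: ereal_inf_lbound; exists 1 => //; split => //.
  by under [X in modular _ _ X]eq_fun do rewrite inve1 mule1.
have norm0 : (0 <= Orlicz_norm Omega phi (EFin \o f))%E.
  by apply: le_ereal_inf_tmp => _ [l [l0 _] <-]; rewrite lee_fin ltW.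
have : (Orlicz_norm Omega phi (maximal Omega f) < (Num.max K 1 + 1)%:E)%E.
  apply: le_lt_trans (bndK _ fO) _.
  apply: (@le_lt_trans _ _ ((Num.max K 1)%:E * 1)%E).
    apply: (@le_trans _ _ ((Num.max K 1)%:E * Orlicz_norm Omega phi (EFin \o f))%E).
      by rewrite lee_wpmul2r// lee_fin le_max lexx.
    by rewrite lee_wpmul2l// lee_fin le_max ler01 orbT.
  by rewrite mule1 lte_fin ltrDl.
move=> /ereal_inf_lt[_ [l [l0 l1] <-]]; rewrite lte_fin => /ltW lK.
by exists l.
Qed.

End Phi_growth.

Lemma root_exists (R : realType) (n : nat) (c : R) : 0 < c ->
  exists2 r : R, 0 < r & r ^+ n.+1 = c.
Proof.
move=> c0; exists (c `^ n.+1%:R^-1); first exact: powR_gt0.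
by rewrite -powR_mulrn ?powR_ge0// -powRrM mulVf ?pnatr_eq0// powRr1// ltW.
Qed.


(** * The gain at one scale *)

Section one_scale.
Context (R : realType) (n : nat) (Omega : set (euclidean R n)).
Context (phi : 'rV[R]_n.+1 -> R -> \bar R) (Pw : Phi_w Omega phi).
Local Notation V := 'rV[R]_n.+1.
Local Notation mu := (leb : {measure set (euclidean R n) -> \bar R}).

Context (w : R) (w0 : 0 < w) (wE : mu (l2ball (0 : V) 1) = w%:E).
Context (b : R) (E : set V) (b0 : 0 < b) (b1 : b < 1) (E0 : mu.-negligible E).
Hypothesis osc : forall x y (rho T s s' : R), Omega x -> Omega y ->
  ~ E x -> ~ E y -> l2norm (x - y) < rho -> 1 < T ->
  T * (w * (2 * rho) ^+ n.+1) <= 1 ->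
  0 <= s' -> s' < b * s -> (phi x s < T%:E)%E -> (phi y s' < T%:E)%E.
Context (L : R) (L1 : 1 <= L).
Hypothesis phiL : forall x, Omega x ->
  almost_increasing L [set t | 0 < t] (fun t => phi x t / t%:E)%E.
Context (K : R) (K1 : 1 <= K).
Hypothesis bndK : forall f : V -> R,
  measurable_fun Omega (f : euclidean R n -> R) ->
  (modular Omega phi (EFin \o f) <= 1)%E ->
  exists l : R, [/\ 0 < l, l <= K &
    (modular Omega phi (fun x => maximal Omega f x / l%:E) <= 1)%E].

Let q : R := 2 ^+ n.+1.
(** The smallest ball has volume kappa / (A M).  This is the largest value for
    which the doubled ball meets the volume condition of (A1) at the level
    2 A M, the assumed bound for phi x (A u). *)
Definition kappa : R := (2 * q)^-1.
(** On ring j the maximal function, divided by K, is at least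
    s = (b A u / 2) / (q ^ j.+1 K), where the factor b / 2 is lost in the height of the
    bump.  Passing from y back to x costs b / 2 once more, and gamma collects
    these losses: (b / 2) s = gamma A u / q ^ j. *)
Definition gamma : R := b ^+ 2 / (4 * K * q).
Context (J : nat) (LJ : L < J%:R * (kappa * gamma)).
(** With this value the argument (b / 2) s becomes q ^ (J - j) u, which stays in
    [u, A u] for the J rings j < J.  Each ring contributes kappa gamma / L to the
    modular, so the choice of J makes the total exceed 1. *)
Definition jump : R := q ^+ J / gamma.

Let q2 : 2 <= q.
Proof. by rewrite /q exprS ler_peMr// exprn_ege1// ler1n. Qed.

Let q1 : 1 <= q. Proof. by apply: le_trans q2; rewrite ler1n. Qed.
Let q0 : 0 < q. Proof. by apply: lt_le_trans q2. Qed.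
Let L0 : 0 < L. Proof. exact: lt_le_trans L1. Qed.
Let K0 : 0 < K. Proof. exact: lt_le_trans K1. Qed.
Let kappa0 : 0 < kappa. Proof. by rewrite invr_gt0 mulr_gt0. Qed.
Let gamma0 : 0 < gamma.
Proof. by rewrite divr_gt0 ?exprn_gt0// !mulr_gt0. Qed.
Let gamma1 : gamma <= 1.
Proof.
rewrite ler_pdivrMr ?mulr_gt0// mul1r.
have : b ^+ 2 <= 1 by rewrite expr_le1// ltW.
have : 1 * 1 <= K * q by apply: ler_pM.
lra.
Qed.
Let jump_gt0 : 0 < jump. Proof. by rewrite divr_gt0 ?exprn_gt0. Qed.

Lemma jump_gt1 : 1 < jump.
Proof.
have J0 : (0 < J)%N.
  case: J LJ => // ; rewrite mul0r => /(lt_trans L0); by rewrite ltxx.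
rewrite /jump ltr_pdivlMr// mul1r; apply: le_lt_trans gamma1 _.
by rewrite exprn_egt1 ?gtn_eqF//; apply: lt_le_trans q2; rewrite ltr1n.
Qed.

(** The modular of the maximal function of a bump at x is computed ring by ring.
    The number M is a lower bound for phi x u and not its value, so that an infinite
    value needs no separate treatment.  The last hypothesis keeps the largest
    ball, of volume kappa gamma / M, inside the ball of radius eps. *)
Lemma jump_growth (x : V) (u M eps : R) : Omega x -> ~ E x -> 0 < eps ->
  l2ball x eps `<=` Omega -> 0 < u -> (M%:E <= phi x u)%E -> L < M ->
  kappa * gamma <= M * (w * eps ^+ n.+1) ->
  ((2 * jump * M)%:E <= phi x (jump * u))%E.
Proof.
move=> Ox Ex eps0 BO u0 Mu LM Meps; rewrite leNgt; apply/negP => phiA.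
have M0 : 0 < M by exact: lt_trans LM.
have M1 : 1 < M by exact: le_lt_trans LM.
have A1 : 1 <= jump by exact: ltW jump_gt1.
pose v := kappa / (jump * M).
have v0 : 0 < v by rewrite divr_gt0// mulr_gt0.
have [r0 r00 r0v] : exists2 r0 : R, 0 < r0 & r0 ^+ n.+1 = v / w.
  by apply: root_exists; rewrite divr_gt0.
pose r (j : nat) := 2 ^+ j * r0.
have r_gt0 j : 0 < r j by rewrite mulr_gt0// exprn_gt0.
have rX j : r j ^+ n.+1 = q ^+ j * v / w.
  by rewrite /r exprMn -exprM mulnC exprM r0v mulrA.
pose B j : set (euclidean R n) := l2ball x (r j).
have mB j : measurable (B j) by exact: measurable_l2ball.
have muB j : mu (B j) = (q ^+ j * v)%:E.
  by rewrite /B lebesgue_l2ball// wE rX -EFinM divfK ?gt_eqF.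
have r_le i j : (i <= j)%N -> r i <= r j.
  by move=> ij; rewrite /r ler_pM2r// ler_weXn2l// ler1n.
have B_le i j : (i <= j)%N -> B i `<=` B j.
  by move=> ij y; rewrite /B /l2ball /= => /lt_le_trans; apply; exact: r_le.
have BOmega j : (j <= J)%N -> B j `<=` Omega.
  move=> jJ y By; apply: BO; suff rj : r j <= eps.
    by move: By; rewrite /B /l2ball /= => /lt_le_trans; apply.
  rewrite -(@ler_pXn2r _ n.+1) ?nnegrE ?(ltW eps0) ?(ltW (r_gt0 j))//.
  apply: (@le_trans _ _ (r J ^+ n.+1)).
    by rewrite lerXn2r ?nnegrE ?(ltW (r_gt0 _))//; exact: r_le.
  rewrite rX ler_pdivrMr//.
  have -> : q ^+ J * v = kappa * gamma / M.
    by rewrite /v /jump; field; rewrite !gt_eqF// exprn_gt0.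
  rewrite ler_pdivrMr// (_ : _ * w * M = M * (w * eps ^+ n.+1))//; ring.
(* The halving makes sigma strictly smaller than b A u, as (A1) requires. *)
pose sigma := b * (jump * u) / 2.
have sigma0 : 0 < sigma by rewrite /sigma divr_gt0// mulr_gt0// mulr_gt0.
have T1 : 1 < 2 * jump * M.
  apply: (lt_le_trans M1); rewrite ler_peMl ?ltW//; lra.
have q2kappa : 2 * q * kappa = 1 by rewrite /kappa divff// gt_eqF// mulr_gt0.
have vE : jump * M * v = kappa by rewrite /v mulrC divfK// gt_eqF// mulr_gt0.
have below y : B 0%N y -> ~ E y -> (phi y sigma <= (2 * jump * M)%:E)%E.
  move=> By Ey; have Oy : Omega y by exact: BOmega By.
  apply/ltW; apply: (osc (x := x) (rho := r 0%N) (s := jump * u)) => //.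
  - by rewrite l2norm_sym.
  - rewrite exprMn -/q rX expr0 mul1r.
    have -> : 2 * jump * M * (w * (q * (v / w))) = (2 * q) * (jump * M * v).
      by field; rewrite gt_eqF.
    by rewrite vE q2kappa.
  - exact: ltW.
  - have : 0 < b * (jump * u) by rewrite mulr_gt0// mulr_gt0.
    rewrite /sigma; lra.
pose f := bump sigma x (r 0%N).
have f1 : (modular Omega phi (EFin \o f) <= 1)%E.
  apply: (@le_trans _ _ ((2 * jump * M)%:E * mu (B 0%N))%E).
    apply: (@integral_supported_le _ _ _ mu Omega (B 0%N) E) => //.
    - by rewrite ltW// (lt_trans _ T1).
    - by move=> y Oy; exact: Phi_abs_ge0 Pw _ _ Oy.
    - move=> y Oy By; rewrite /f /bump /Phi_abs /= indicE memNset//.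
      by rewrite mulr0 normr0 (Phi_w_at0 Pw Oy).
    - move=> y Oy By Ey; rewrite /f /bump /Phi_abs /= indicE mem_set//.
      by rewrite mulr1 gtr0_norm//; exact: below.
  rewrite muB expr0 mul1r -EFinM lee_fin.
  have -> : 2 * jump * M * v = 2 * kappa by rewrite -vE; ring.
  have : 1 * kappa <= q * kappa by rewrite ler_pM2r.
  by move: q2kappa; lra.
have [l [l0 lK modM]] := bndK (@measurable_bump _ _ Omega sigma x (r 0%N)) f1.
(* T j is a lower bound for phi at x and the argument q ^ (J - j) u, carried over
   to the ring D j by (A1). *)
pose D (j : 'I_J) := B j.+1 `\` B j.
pose T (j : 'I_J) := q ^+ (J - j) * M / L.
have T_gt1 j : 1 < T j.
  rewrite /T -mulrA; apply: (@lt_le_trans _ _ (M / L)); first by rewrite ltr_pdivlMr// mul1r.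
  by rewrite ler_peMl//; [exact/ltW/divr_gt0 | exact: exprn_ege1].
have qJ (j : 'I_J) : q ^+ J = q ^+ (J - j) * q ^+ j.
  by rewrite -exprD subnK// ltnW.
have above (j : 'I_J) y : D j y -> ~ E y ->
    ((T j)%:E <= Phi_abs phi y (maximal Omega f y / l%:E))%E.
  move=> [By nBy] Ey; have Oy : Omega y by exact: BOmega By.
  pose s := sigma / q ^+ j.+1 / K.
  have s_gt0 : 0 < s by rewrite divr_gt0// divr_gt0// exprn_gt0.
  have s0 : 0 <= s by exact: ltW.
  have sM : (s%:E <= maximal Omega f y / l%:E)%E.
    rewrite inver gt_eqF// lee_pdivlMr//.
    have rj : r 0%N <= r j.+1 by exact: r_le.
    have := maximal_bump_ge (ltW sigma0) (r_gt0 j.+1) rj (BOmega _ (leq0n J)) By.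
    apply: le_trans.
    have qv0 : 0 < q ^+ j.+1 * v by rewrite mulr_gt0// exprn_gt0.
    rewrite -/(B _) -/(B _) !muB inver (gt_eqF qv0).
    rewrite -EFinM -!EFinM lee_fin expr0 mul1r.
    have -> : sigma * v / (q ^+ j.+1 * v) = sigma / q ^+ j.+1.
      by field; rewrite !gt_eqF// exprn_gt0.
    have X0 : 0 < sigma / q ^+ j.+1 by rewrite divr_gt0// exprn_gt0.
    by rewrite /s mulrAC ler_pdivrMr// ler_pM2l.
  apply: le_trans (Phi_abs_ge Pw Oy s0 sM).
  rewrite leNgt; apply/negP => phiy.
  (* (A1) from y to x would make phi x smaller than almost monotonicity allows. *)
  have : (phi x (q ^+ (J - j) * u) < (T j)%:E)%E.
    apply: (osc (x := y) (rho := r j.+1) (s := s)) => //.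
    - rewrite exprMn -/q rX.
      have -> : T j * (w * (q * (q ^+ j.+1 * v / w))) = (q / 2) * gamma / L.
        rewrite /T /v /jump /kappa (qJ j) (exprS q j); field.
        by rewrite !gt_eqF// exprn_gt0.
      rewrite ler_pdivrMr// mul1r; apply: le_trans L1.
      rewrite /gamma.
      have -> : q / 2 * (b ^+ 2 / (4 * K * q)) = b ^+ 2 / (8 * K).
        by field; rewrite !gt_eqF.
      rewrite ler_pdivrMr ?mulr_gt0// mul1r.
      have : b ^+ 2 <= 1 by rewrite expr_le1// ltW.
      move: K1; lra.
    - by rewrite mulr_ge0 ?exprn_ge0 ?ltW.
    - have -> : b * s = 2 * (q ^+ (J - j) * u).
        rewrite /s /sigma /jump /gamma (qJ j) (exprS q j); field.
        by rewrite !gt_eqF// exprn_gt0.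
      have : 0 < q ^+ (J - j) * u by rewrite mulr_gt0// exprn_gt0.
      lra.
  apply/negP; rewrite -leNgt.
  have uQ : u <= q ^+ (J - j) * u.
    by rewrite ler_peMl//; [exact: ltW | exact: exprn_ege1].
  have := almost_increasing_growth Pw L1 (phiL Ox) u0 uQ (ltW M0) Mu Ox.
  by rewrite mulfK ?gt_eqF// [M * _]mulrC.
have tD : trivIset setT D.
  apply/trivIsetP => i j _ _.
  wlog ij : i j / (i < j)%N.
    move=> h; rewrite neq_ltn => /orP[ij|ji]; first by apply: h => //; rewrite neq_ltn ij.
    by rewrite setIC; apply: h => //; rewrite neq_ltn ji.
  move=> _; rewrite -subset0 => y [[Byi _] [_ nByj]]; apply: nByj.
  exact: B_le Byi.
have muD (j : 'I_J) : ((q ^+ j * v)%:E <= mu (D j))%E.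
  rewrite /D measureD//; last by rewrite [X in (X < _)%E]muB ltry.
  rewrite setIidr; last exact: B_le.
  rewrite [X in (_ <= X - _)%E]muB [X in (_ <= _ - X)%E]muB -EFinB lee_fin (exprS q j).
  have : 0 <= (q - 2) * (q ^+ j * v).
    rewrite mulr_ge0 ?subr_ge0//; apply/ltW/mulr_gt0 => //; exact: exprn_gt0.
  lra.
have : (\sum_(j < J) (T j)%:E * mu (D j) <= 1)%E.
  apply: le_trans modM; apply: (sum_le_integral _ _ tD E0) => //.
  - by move=> j; rewrite ltW// (lt_trans _ (T_gt1 j)).
  - by move=> j; exact: measurableD.
  - by move=> j y [By _]; exact: BOmega By.
  - by move=> y Oy; exact: Phi_abs_ge0 Pw _ _ Oy.
apply/negP; rewrite -ltNge.
apply: (@lt_le_trans _ _ (\sum_(j < J) ((kappa * gamma) / L)%:E)%E).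
  rewrite sumEFin lte_fin sumr_const card_ord -mulr_natl mulrA.
  by rewrite ltr_pdivlMr// mul1r.
apply: lee_sum => j _.
apply: (@le_trans _ _ ((T j)%:E * (q ^+ j * v)%:E)%E); last first.
  by rewrite lee_pmul2l ?lte_fin ?(lt_trans _ (T_gt1 j))//; exact: muD.
rewrite -EFinM lee_fin le_eqVlt; apply/orP; left; apply/eqP.
rewrite /T /v /jump (qJ j); field.
by rewrite !gt_eqF// exprn_gt0.
Qed.

End one_scale.

(** * From one scale to a power *)

Section iteration.
Context (R : realType).

(** The exponent is d = ln 2 / ln A, so that A ^ d = 2; k is the integer part of
    ln (s / t) / ln A. *)
Lemma geometric_scale (A : R) : 1 < A -> exists2 d : R, 0 < d &
  forall s t : R, 0 < t -> t <= s -> exists k : nat,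
    A ^+ k * t <= s /\ s `^ d <= 2 ^+ k.+1 * t `^ d.
Proof.
move=> A1; have A0 : 0 < A by exact: lt_trans A1.
have lnA : 0 < ln A by exact: ln_gt0.
have ln2 : 0 < ln (2 : R) by rewrite ln_gt0// ltr1n.
exists (ln 2 / ln A); first exact: divr_gt0.
move=> s t t0 ts; have s0 : 0 < s by exact: lt_le_trans ts.
have lnst : 0 <= ln s - ln t by rewrite subr_ge0 ler_ln.
have y0 : 0 <= (ln s - ln t) / ln A by rewrite divr_ge0// ltW.
have /andP[ky yk] := truncn_itv y0; set k := Num.truncn _ in ky yk.
exists k; split.
  rewrite -(lnK A0) -(lnK t0) -(lnK s0) -expRM_natl -expRD ler_expR.
  by move: ky; rewrite ler_pdivlMr//; lra.
rewrite /powR !gt_eqF// -[X in X ^+ _]lnK ?posrE// -expRM_natl -expRD ler_expR.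
move: yk; rewrite ltr_pdivrMr// => yk.
rewrite -(ler_pM2r lnA) mulrDl.
have -> : ln 2 / ln A * ln s * ln A = ln 2 * ln s by field; rewrite gt_eqF.
have -> : ln 2 / ln A * ln t * ln A = ln 2 * ln t by field; rewrite gt_eqF.
have h : ln 2 * (ln s - ln t) <= ln 2 * (k.+1%:R * ln A).
  by rewrite ler_pM2l// ltW.
lra.
Qed.

(** Between t and s there are k jumps, contributing (2 A) ^ k, and a remaining
    factor s / (A ^ k t), on which g grows linearly up to L.  So g s is at least
    2 ^ k (s / t) g t / L, and 2 ^ k.+1 >= (s / t) ^ d.  The exponent d is an
    argument because it must not depend on g. *)
Lemma aInc_of_jump (g : R -> \bar R) (L A t0 M0 : R) : 1 <= L -> 1 < A ->
  0 < t0 -> 0 < M0 ->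
  (forall s t, 0 < s -> s <= t -> (g s <= g t)%E) ->
  (forall s t M, 0 < s -> s <= t -> 0 <= M -> (M%:E <= g s)%E ->
    ((M * (t / s) / L)%:E <= g t)%E) ->
  (M0%:E <= g t0)%E ->
  (forall u M, t0 <= u -> M0 <= M -> (M%:E <= g u)%E ->
    ((2 * A * M)%:E <= g (A * u)%R)%E) ->
  forall d, (forall s t : R, 0 < t -> t <= s -> exists k : nat,
    A ^+ k * t <= s /\ s `^ d <= 2 ^+ k.+1 * t `^ d) ->
  forall s t, t0 <= s -> t0 <= t -> t < s ->
    (g t / (t `^ (1 + d))%:E <= (2 * L)%:E * (g s / (s `^ (1 + d))%:E))%E.
Proof.
move=> L1 A1 t00 M00 gmono ggrow gt0 gjump d scaleA s t t0s t0t ts.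
have L0 : 0 < L by exact: lt_le_trans L1.
have A0 : 0 < A by exact: lt_trans A1.
have t_gt0 : 0 < t by exact: lt_le_trans t0t.
have s_gt0 : 0 < s by exact: lt_trans ts.
have [k [Ak sd]] := scaleA s t t_gt0 (ltW ts).
have iter j M : M0 <= M -> (M%:E <= g t)%E ->
    (((2 * A) ^+ j * M)%:E <= g (A ^+ j * t)%R)%E.
  move=> M0M Mt; elim: j => [|j ih]; first by rewrite !expr0 !mul1r.
  rewrite !exprS -!(mulrA (2 * A)) -(mulrA A); apply: gjump => //.
    by apply: le_trans t0t _; rewrite ler_peMl//; [exact: ltW|rewrite exprn_ege1// ltW].
  apply: (le_trans M0M); rewrite ler_peMl//; first exact/ltW/(lt_le_trans M00 M0M).
  by rewrite exprn_ege1//; move: A1; lra.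
have gt_M0 : (M0%:E <= g t)%E by apply: le_trans gt0 _; exact: gmono.
have gts : (g t <= g s)%E by apply: gmono => //; exact: ltW.
have p0 x : 0 < x -> 0 < x `^ (1 + d) by exact: powR_gt0.
rewrite !inver !gt_eqF ?p0//.
move: gt_M0 gts; case gtE : (g t) => [M| |] //; case gsE : (g s) => [e| |] //.
- rewrite !lee_fin => M0M Me.
  have M_gt0 : 0 < M by exact: lt_le_trans M0M.
  have Akt : 0 < A ^+ k * t by rewrite mulr_gt0// exprn_gt0.
  have AM0 : 0 < (2 * A) ^+ k * M by rewrite mulr_gt0// exprn_gt0// mulr_gt0.
  have Mk : (((2 * A) ^+ k * M)%:E <= g (A ^+ k * t)%R)%E by apply: iter => //; rewrite gtE.
  have := ggrow _ s _ Akt Ak (ltW AM0) Mk; rewrite gsE lee_fin exprMn.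
  have -> : 2 ^+ k * A ^+ k * M * (s / (A ^+ k * t)) / L = 2 ^+ k * M * s / (t * L).
    by field; rewrite !gt_eqF// exprn_gt0.
  rewrite ler_pdivrMr ?mulr_gt0// => low.
  have powS x : 0 < x -> x `^ (1 + d) = x * x `^ d.
    move=> x0; rewrite powRD ?powRr1 ?(ltW x0)//.
    by apply/implyP => _; rewrite gt_eqF.
  have td0 : 0 < t `^ d by exact: powR_gt0.
  have sd0 : 0 < s `^ d by exact: powR_gt0.
  rewrite !powS// -(ler_pM2r (_ : 0 < t * t `^ d * (s * s `^ d))); last by rewrite !mulr_gt0.
  have -> : M / (t * t `^ d) * (t * t `^ d * (s * s `^ d)) = M * s * s `^ d.
    by field; rewrite !gt_eqF.
  have -> : 2 * L * (e / (s * s `^ d)) * (t * t `^ d * (s * s `^ d)) =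
      2 * L * e * t * t `^ d by field; rewrite !gt_eqF.
  apply: (@le_trans _ _ (M * s * (2 ^+ k.+1 * t `^ d))).
    by rewrite ler_pM2l// mulr_gt0.
  rewrite exprS.
  have : 2 ^+ k * M * s * (2 * t `^ d) <= e * (t * L) * (2 * t `^ d).
    by rewrite ler_wpM2r// mulr_ge0// ltW.
  lra.
- by rewrite gt0_mulye ?lte_fin ?invr_gt0 ?p0// gt0_muley ?leey// lte_fin mulr_gt0.
- by rewrite !gt0_mulye ?lte_fin ?invr_gt0 ?p0// gt0_muley ?lte_fin ?mulr_gt0.
Qed.

End iteration.

(** * The theorem *)

Section exhaustion.
Context (R : realType) (n : nat).
Local Notation V := 'rV[R]_n.+1.
Local Notation mu := (leb : {measure set (euclidean R n) -> \bar R}).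

Lemma lebesgue_null_of_null_ball : mu (l2ball (0 : V) 1) = 0%E ->
  mu.-negligible (setT : set (euclidean R n)).
Proof.
move=> B0.
have null k : mu.-negligible (l2ball (0 : V) k.+1%:R : set (euclidean R n)).
  exists (l2ball (0 : V) k.+1%:R); split => //; first exact: measurable_l2ball.
  by rewrite lebesgue_l2ball// B0 mule0.
apply: negligibleS (negligible_bigcup null) => x _.
exists (Num.bound (l2norm x)) => //; rewrite /l2ball /= subr0.
apply: lt_trans (archi_boundP (sqrtr_ge0 _)) _.
by rewrite ltr_nat.
Qed.

Lemma l2ball_sub_of_shrink (Omega : set V) (eps : R) (x : V) :
  shrink Omega eps x -> l2ball x eps `<=` Omega.
Proof.
move=> [_ dist] y xy; apply: contrapT => nOy.
move: dist; apply/negP; rewrite -leNgt; apply: (@le_trans _ _ (l2norm (x - y))%:E).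
  by apply: ereal_inf_lbound; exists y.
by rewrite lee_fin l2norm_sym ltW.
Qed.

End exhaustion.

Theorem theorem4p1 (R : realType) (n : nat) (Omega : set 'rV[R]_n.+1)
  (phi : 'rV[R]_n.+1 -> R -> \bar R) :
  open Omega ->
  Phi_w Omega phi -> A0 Omega phi -> A1 Omega phi -> A2 Omega phi ->
  maximal_bounded Omega phi ->
  forall eps : R, 0 < eps -> aInc_infty (shrink Omega eps) phi.
Proof.
move=> _ Pw phiA0 phiA1 _ bndM eps eps0.
pose mu := (leb : {measure set (euclidean R n) -> \bar R}).
pose w := fine (mu (l2ball (0 : 'rV[R]_n.+1) 1)).
have wE : mu (l2ball (0 : 'rV[R]_n.+1) 1) = w%:E.
  by rewrite fineK// ge0_fin_numE//; exact: lebesgue_l2ball_fin.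
have : (0 <= mu (l2ball (0 : 'rV[R]_n.+1) 1)%R)%E by exact: measure_ge0.
rewrite wE lee_fin le_eqVlt => /orP[/eqP w0|w0].
  (* A null unit ball makes the whole space null; any exponent will do. *)
  exists 2, 1; split => //; first by rewrite ltr1n.
  exists 1 => //; apply: negligibleS (@subsetT _ _) _.
  by apply: lebesgue_null_of_null_ball; rewrite -/mu wE -w0.
have [b [b0 b1 [E E0 osc]]] := A1_pointwise Pw w0 wE phiA1.
have [u0 u00 phiu0] := A0_pointwise Pw phiA0.
have [L L1 phiL] := Phi_w_aInc1 Pw.
have [K K1 bndK] := maximal_bounded_modular bndM.
have L0 : 0 < L by exact: lt_le_trans L1.
have K0 : 0 < K by exact: lt_le_trans K1.
pose c := kappa R n * gamma n b K.
have c0 : 0 < c.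
  by rewrite mulr_gt0// ?invr_gt0 ?divr_gt0 ?exprn_gt0 ?mulr_gt0 ?exprn_gt0.
pose J := Num.bound (L / c).
have LJ : L < J%:R * c.
  by rewrite -ltr_pdivrMr//; apply: archi_boundP; rewrite divr_ge0 ?ltW.
pose A := jump n b K J.
have A_gt1 : 1 < A by exact: (jump_gt1 b0 b1 L1 K1 LJ).
have [d d0 scaleA] := geometric_scale A_gt1.
pose M0 := Num.max (L + 1) (c / (w * eps ^+ n.+1)).
have LM0 : L < M0 by rewrite lt_max ltrDl ltr01.
have cM0 : c <= M0 * (w * eps ^+ n.+1).
  by rewrite -ler_pdivrMr ?mulr_gt0 ?exprn_gt0// le_max lexx orbT.
have M00 : 0 < M0 by exact: lt_trans LM0.
(* phi x u0 >= 1 by (A0), and t0 / u0 = L M0 makes phi x t0 >= M0. *)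
pose t0 := u0 * (L * M0).
have t00 : 0 < t0 by rewrite !mulr_gt0.
have u0t0 : u0 <= t0.
  rewrite ler_peMr//; first exact: ltW.
  by rewrite -[1]mulr1; apply: ler_pM => //; apply: (le_trans L1); exact: ltW.
exists (1 + d), t0; split => //; first by rewrite ltrDl.
exists (2 * L); first by move: L1; lra.
have Eae : {ae leb, forall x : euclidean R n, ~ E x} by apply: negligibleS E0 => x /= /contrapT.
apply: filterS2 Eae phiu0 => x Ex phix1 Ox s t /= t0s t0t t_gt0 ts.
have Omx : Omega x by case: Ox.
have BO := l2ball_sub_of_shrink Ox.
apply: (@aInc_of_jump _ (phi x) L A t0 M0) => //.
- by move=> a e a0 ae; exact: Phi_w_nondecreasing Pw _ _ _ Omx (ltW a0) ae.
- move=> a e M a0 ae Mge Mphi.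
  exact: (almost_increasing_growth Pw L1 (phiL _ Omx) a0 ae Mge Mphi Omx).
- have := almost_increasing_growth Pw L1 (phiL _ Omx) u00 u0t0 ler01 (phix1 Omx) Omx.
  suff -> : 1 * (t0 / u0) / L = M0 by [].
  by rewrite /t0; field; rewrite !gt_eqF.
- move=> u M t0u M0M Mphi.
  apply: (jump_growth Pw w0 wE b0 b1 E0 osc L1 phiL K1 bndK LJ Omx Ex eps0 BO _ Mphi).
  + exact: lt_le_trans t0u.
  + exact: lt_le_trans M0M.
  + by apply: (le_trans cM0); rewrite ler_pM2r// mulr_gt0// exprn_gt0.
Qed.
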